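(* Let $\Omega:\mathbb M_m\to\mathbb M_n$ be completely positive with minimal Kraus representation $\Omega(B)=\sum_{i=1}^r V_i^*BV_i$ (so $V_1,\dots,V_r$ are linearly independent matrices from $\mathbb C^n$ to $\mathbb C^m$), and let $\Lambda:\mathbb M_\ell\to\mathbb M_m$ be completely positive with a (not necessarily minimal) Kraus representation $\Lambda(A)=\sum_{j=1}^s L_j^*AL_j$. Let $$\mathcal R_{\Lambda,\Omega}=\Big\{c=(c_{ji})\in\mathbb C^s\otimes\mathbb C^r:\ \sum_{j=1}^s\sum_{i=1}^r c_{ji}\,L_jV_i=0\Big\},\qquad \mathcal E_{\Lambda,\Omega}=\mathcal R_{\Lambda,\Omega}^{\perp}\subseteq\mathbb C^s\otimes\mathbb C^r,$$ and let $P_{\mathcal E}$ be the orthogonal projection of $\mathbb C^s\otimes\mathbb C^r$ onto $\mathcal E_{\Lambda,\Omega}$. Then, under the identifications $\pi_\Omega(\mathbb M_m)'\cong\mathbb M_r$ and $\pi_{\Omega\circ\Lambda}(\mathbb M_\ell)'\cong B(\mathcal E_{\Lambda,\Omega})$, the pullback transfer map is represented by $$\mathcal T_\Lambda^\Omega(D)=P_{\mathcal E}(I_s\otimes D)P_{\mathcal E}\big|_{\mathcal E_{\Lambda,\Omega}},\qquad D\in\mathbb M_r.$$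
   Context: For completely positive maps, $\Phi\le\Psi$ means $\Psi-\Phi$ is completely positive. Radon--Nikodym theorem (known): if $\Psi(C)=T^*\sigma(C)T$ is a minimal Stinespring representation of a completely positive map and $\Phi$ is completely positive with $\Phi\le c\,\Psi$ for some $c\ge0$, there is a unique positive $E$ in the commutant of the range of $\sigma$ with $\Phi(C)=T^*\sigma(C)ET$ for all $C$; it is denoted $\frac{\mathrm d\Phi}{\mathrm d\Psi}$. Identification for $\Omega$: with $(f_i)$ the standard basis of $\mathbb C^r$, the minimal Stinespring representation is $\pi_\Omega(B)=B\otimes I_r$ on $\mathbb C^m\otimes\mathbb C^r$ with $\mathsf V_\Omega\xi=\sum_iV_i\xi\otimes f_i$; $D=[d_{ij}]\in\mathbb M_r$ is identified with $I_m\otimes D\in\pi_\Omega(\mathbb M_m)'$. Thus for $D\ge 0$, $\Omega_D(B):=\mathsf V_\Omega^*(B\otimes I_r)(I_m\otimes D)\mathsf V_\Omega=\sum_{i,j}d_{ij}V_i^*BV_j$. Identification for $\Omega\circ\Lambda$: one has $\Omega\circ\Lambda(A)=\sum_{j,i}(L_jV_i)^*A(L_jV_i)$, and the coefficient space of the composite Kraus family $\{L_jV_i\}$ is $\mathbb C^s\otimes\mathbb C^r$. Restricting this coefficient space to $\mathcal E_{\Lambda,\Omega}$ removes the linear redundancies of the family, and the minimal Stinespring representation of $\Omega\circ\Lambda$ is taken on $\mathbb C^\ell\otimes\mathcal E_{\Lambda,\Omega}$ with $\pi_{\Omega\circ\Lambda}(A)=A\otimes I_{\mathcal E_{\Lambda,\Omega}}$;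 an operator $X\in B(\mathcal E_{\Lambda,\Omega})$ is identified with $I_\ell\otimes X\in\pi_{\Omega\circ\Lambda}(\mathbb M_\ell)'$. Pullback transfer map: $\mathcal T_\Lambda^\Omega(D)=\frac{\mathrm d(\Omega_D\circ\Lambda)}{\mathrm d(\Omega\circ\Lambda)}$ for $D\ge0$, the derivative being computed with respect to the minimal Stinespring representation of $\Omega\circ\Lambda$, and extended linearly to all $D\in\mathbb M_r$.
   Formalization: The space E is taken as the annihilator of R under the bilinear pairing sum c_ji x_ji (the entrywise conjugate of the Hermitian complement R^⊥); with the Hermitian complement the formula fails, e.g. for L=(1,i), V_1=e_1, V_2=e_2. *)

(* Defs.v *)
From mathcomp Require Import all_boot all_order all_algebra.
From mathcomp Require Import spectral sesquilinear.
From mathcomp Require Import mxtens complex.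
From mathcomp Require Import boolp classical_sets reals.

Set Implicit Arguments.
Unset Strict Implicit.
Unset Printing Implicit Defensive.

Import Order.TTheory GRing.Theory Num.Theory.
Local Open Scope ring_scope.
Local Open Scope classical_set_scope.
Local Open Scope sesquilinear_scope.

Section CompletelyPositiveMaps.
Variable C : numClosedFieldType.

(* Over C, [0 <= z] forces z to be real, so psd matrices are hermitian. *)
Definition psd d (A : 'M[C]_d) : Prop :=
  forall x : 'cV[C]_d, 0 <= (x ^t* *m A *m x) 0 0.

Definition completely_positive m n (Phi : 'M[C]_m -> 'M[C]_n) : Prop :=
  forall k (A : 'I_k -> 'I_k -> 'M[C]_m),
    psd (\mxblock_(i < k, j < k) A i j) ->
    psd (\mxblock_(i < k, j < k) Phi (A i j)).

Definition kraus m n r (Phi : 'M[C]_m -> 'M[C]_n)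
    (V : 'I_r -> 'M[C]_(m, n)) : Prop :=
  forall B, Phi B = \sum_i (V i) ^t* *m B *m V i.

Definition minimal_kraus m n r (Phi : 'M[C]_m -> 'M[C]_n)
    (V : 'I_r -> 'M[C]_(m, n)) : Prop :=
  kraus Phi V /\ free [tuple V i | i < r].

(* Unital *-representations of M_l on C^d. *)
Definition star_rep l d (sigma : 'M[C]_l -> 'M[C]_d) : Prop :=
  [/\ linear sigma, sigma 1%:M = 1%:M,
      (forall A B, sigma (A *m B) = sigma A *m sigma B) &
      (forall A, sigma (A ^t*) = (sigma A) ^t*)].

(* The last clause says that the vectors sigma(A) T x span C^d. *)
Definition minimal_stinespring l n d (Psi : 'M[C]_l -> 'M[C]_n)
    (sigma : 'M[C]_l -> 'M[C]_d) (T : 'M[C]_(d, n)) : Prop :=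
  [/\ star_rep sigma,
      (forall A, Psi A = T ^t* *m sigma A *m T) &
      (forall U : {vspace 'cV[C]_d},
         (forall A (x : 'cV[C]_n), sigma A *m T *m x \in U) -> U = fullv)].

(* E = dPhi/dPsi with respect to the minimal Stinespring representation
   (sigma, T) of Psi.  That Phi is completely positive and Phi <= c Psi for some
   c >= 0 follows from the existence of E. *)
Definition radon_nikodym l n d (Phi Psi : 'M[C]_l -> 'M[C]_n)
    (sigma : 'M[C]_l -> 'M[C]_d) (T : 'M[C]_(d, n)) (E : 'M[C]_d) : Prop :=
  [/\ minimal_stinespring Psi sigma T, psd E,
      (forall A, E *m sigma A = sigma A *m E) &
      (forall A, Phi A = T ^t* *m sigma A *m E *m T)].

(* A |-> A (x) I_k.  Tensor products are Kronecker products; the basis vector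
   e_a (x) f_i of C^m (x) C^r has index [mxtens_index (a, i)]. *)
Definition ampliation l k (A : 'M[C]_l) : 'M[C]_(l * k) := A *t (1%:M : 'M_k).

(* x |-> \sum_i V_i x (x) f_i *)
Definition stinespring_op m n r (V : 'I_r -> 'M[C]_(m, n)) : 'M[C]_(m * r, n) :=
  \matrix_(k, j) V (mxtens_unindex k).2 (mxtens_unindex k).1 j.

(* Omega_D, for the Kraus operators V of Omega *)
Definition weighted_map m n r (V : 'I_r -> 'M[C]_(m, n)) (D : 'M[C]_r)
    (B : 'M[C]_m) : 'M[C]_n :=
  (stinespring_op V) ^t* *m ampliation r B *m ((1%:M : 'M_m) *t D)
    *m stinespring_op V.

Definition composite_kraus l m n r s (L : 'I_s -> 'M[C]_(l, m))
    (V : 'I_r -> 'M[C]_(m, n)) (k : 'I_(s * r)) : 'M[C]_(l, n) :=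
  L (mxtens_unindex k).1 *m V (mxtens_unindex k).2.

Definition relation_space l m n r s (L : 'I_s -> 'M[C]_(l, m))
    (V : 'I_r -> 'M[C]_(m, n)) : set 'cV[C]_(s * r) :=
  [set c | \sum_(j < s) \sum_(i < r)
             c (mxtens_index (j, i)) 0 *: (L j *m V i) = 0].

(* The complement of the relation space is taken for the bilinear pairing
   \sum_k c_k x_k of coefficient families: it is the least subspace F such that
   C^l (x) F contains all \sum_(j, i) L_j V_i xi (x) (g_j (x) f_i), and so the
   one carrying the minimal Stinespring representation.  The sesquilinear
   complement is the entrywise conjugate of this space and need not carry it:
   for s = 1, m = r = 2, l = n = 1, L = (1, 'i), V_1 = e_1, V_2 = e_2, the
   vector \sum_i L V_i (x) f_i = (1, 'i) is itself a relation, so it is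
   orthogonal to that complement. *)
Definition coefficient_space l m n r s (L : 'I_s -> 'M[C]_(l, m))
    (V : 'I_r -> 'M[C]_(m, n)) : set 'cV[C]_(s * r) :=
  [set x | forall c, relation_space L V c -> \sum_k c k 0 * x k 0 = 0].

Definition orthogonal_projection d (F : set 'cV[C]_d) (P : 'M[C]_d) : Prop :=
  [/\ P ^t* = P, P *m P = P & forall x, F x <-> exists y, x = P *m y].

(* The columns of Q form an orthonormal basis of F, i.e. Q is a unitary from C^e
   onto F; it identifies B(F) with the e x e matrices, X going to
   Q^* X Q. *)
Definition orthonormal_basis d e (F : set 'cV[C]_d) (Q : 'M[C]_(d, e)) : Prop :=
  Q ^t* *m Q = 1%:M /\ forall x, F x <-> exists y, x = Q *m y.

Definition restriction_mx d e (Q : 'M[C]_(d, e)) (X : 'M[C]_d) : 'M[C]_e :=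
  Q ^t* *m X *m Q.

(* x |-> \sum_(j, i) L_j V_i x (x) (g_j (x) f_i), with values in C^l (x) E,
   where E is the coefficient space with orthonormal basis Q *)
Definition composite_stinespring_op l m n r s e (L : 'I_s -> 'M[C]_(l, m))
    (V : 'I_r -> 'M[C]_(m, n)) (Q : 'M[C]_(s * r, e)) : 'M[C]_(l * e, n) :=
  ((1%:M : 'M_l) *t (Q ^t*)) *m stinespring_op (composite_kraus L V).

(* [T] is the pullback transfer map, with B(E) written as matrices in the
   orthonormal basis Q.  Being linear, T is determined by its values on psd
   matrices. *)
Definition pullback_transfer l m n r s e (Omega : 'M[C]_m -> 'M[C]_n)
    (Lambda : 'M[C]_l -> 'M[C]_m) (V : 'I_r -> 'M[C]_(m, n))
    (L : 'I_s -> 'M[C]_(l, m)) (Q : 'M[C]_(s * r, e))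
    (T : 'M[C]_r -> 'M[C]_e) : Prop :=
  linear T /\
  forall D, psd D ->
    radon_nikodym (weighted_map V D \o Lambda) (Omega \o Lambda)
      (@ampliation l e) (composite_stinespring_op L V Q)
      ((1%:M : 'M_l) *t T D).

End CompletelyPositiveMaps.

(* Main.v *)
(** Put W xi = \sum_(j, i) L_j V_i xi (x) (g_j (x) f_i).  By definition of the
coefficient space E, each column of coefficients of W lies in E, so
(1 (x) P_E) W = W; hence compressing the second tensor factor to E changes
neither W^* (A (x) 1) W = Omega (Lambda A) nor
W^* (A (x) (1 (x) D)) W = Omega_D (Lambda A).  The compressed representation is
minimal, because a functional killing all (A (x) 1) W xi splits into relations
among the L_j V_i, and these pair to zero with E.  So the compression of
1 (x) D to E is the derivative when D is psd.  Uniqueness of the derivative and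
the fact that psd matrices span M_r give the converse. *)

From HB Require Import structures.
Require Import Defs.
From mathcomp Require Import all_boot all_order all_algebra.
From mathcomp Require Import spectral sesquilinear.
From mathcomp Require Import mxtens complex.
From mathcomp Require Import boolp classical_sets reals.
Import Order.TTheory GRing.Theory Num.Theory.
Local Open Scope ring_scope.
Local Open Scope complex_scope.

Set Implicit Arguments.
Unset Strict Implicit.
Unset Printing Implicit Defensive.
Local Open Scope sesquilinear_scope.

(** * Sums and identities for Kronecker indices *)

Lemma sum_mxtens_index (U : nmodType) (m n : nat) (F : 'I_(m * n) -> U) :
  \sum_k F k = \sum_i \sum_j F (mxtens_index (i, j)).
Proof.
rewrite pair_big /= (reindex (@mxtens_index m n)) /=.
  by apply: eq_bigr => -[i j] _.
by exists (@mxtens_unindex m n) => k _; rewrite ?mxtens_indexK ?mxtens_unindexK.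
Qed.

Lemma tensmx0_inj (R : nzRingType) (l e : nat) (X : 'M[R]_e) :
  (0 < l)%N -> (1%:M : 'M_l) *t X = 0 -> X = 0.
Proof.
move=> l0 X0; apply/matrixP => i j; pose a := Ordinal l0.
have /matrixP/(_ (mxtens_index (a, i)) (mxtens_index (a, j))) := X0.
by rewrite tensmxE !mxE eqxx mul1r.
Qed.

Lemma tensmx11 (R : nzRingType) (l k : nat) :
  (1%:M : 'M[R]_l) *t (1%:M : 'M_k) = 1%:M.
Proof.
apply/matrixP => i j; case: (mxtens_indexP i) => a b.
case: (mxtens_indexP j) => c d; rewrite tensmxE !mxE.
rewrite (inj_eq (can_inj (@mxtens_indexK _ _))) xpair_eqE.
by case: (a == c); case: (b == d); rewrite ?mul1r ?mul0r.
Qed.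

Section NumClosed.
Variable C : numClosedFieldType.

(** * Adjoints, positive semidefinite matrices and subspaces *)

Lemma adjmx_mul m n p (A : 'M[C]_(m, n)) (B : 'M[C]_(n, p)) :
  (A *m B) ^t* = B ^t* *m A ^t*.
Proof. by rewrite trmx_mul map_mxM. Qed.

Lemma adjmxD m n (A B : 'M[C]_(m, n)) : (A + B) ^t* = A ^t* + B ^t*.
Proof. by rewrite linearD map_mxD. Qed.

Lemma adjmx1 n : (1%:M : 'M[C]_n) ^t* = 1%:M.
Proof. by rewrite trmx1 map_mx1. Qed.

Lemma adjmx0 m n : (0 : 'M[C]_(m, n)) ^t* = 0.
Proof. by rewrite trmx0 map_mx0. Qed.

Lemma adjmx_tens m n p q (A : 'M[C]_(m, n)) (B : 'M[C]_(p, q)) :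
  (A *t B) ^t* = A ^t* *t B ^t*.
Proof. by rewrite trmx_tens map_mxT. Qed.

Lemma psd_congr d e (X : 'M[C]_d) (Q : 'M[C]_(d, e)) :
  psd X -> psd (Q ^t* *m X *m Q).
Proof.
by move=> Xpsd x; have := Xpsd (Q *m x); rewrite adjmx_mul !mulmxA.
Qed.

Lemma psd_col_adj d (u : 'cV[C]_d) : psd (u *m u ^t*).
Proof.
move=> x; rewrite mulmxA -mulmxA -{1}[u]trmxCK -adjmx_mul mxE big_ord1 !mxE.
by rewrite mulrC mul_conjC_ge0.
Qed.

(** The quadratic form of 1 (x) D at x is the sum of the forms of D at the k blocks of x. *)
Lemma psd_tens1 k d (D : 'M[C]_d) : psd D -> psd ((1%:M : 'M_k) *t D).
Proof.
move=> Dpsd x.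
pose y (a : 'I_k) : 'cV[C]_d := \col_i x (mxtens_index (a, i)) 0.
suff -> : (x ^t* *m (1%:M *t D) *m x) 0 0
    = \sum_a ((y a) ^t* *m D *m y a) 0 0 by apply: sumr_ge0.
rewrite mxE sum_mxtens_index; apply: eq_bigr => a _.
rewrite mxE; apply: eq_bigr => i _.
rewrite [y a i 0]mxE; congr (_ * _).
rewrite !mxE sum_mxtens_index (bigD1 a) //= [X in _ + X]big1 ?addr0.
  by apply: eq_bigr => j _; rewrite tensmxE !mxE eqxx mul1r.
move=> b ba; apply: big1 => j _.
by rewrite tensmxE [_ b a]mxE (negPf ba) mul0r mulr0.
Qed.

(** Polarisation: each [u *m u ^t*] is psd, which forces f to vanish on every [u *m v ^t*], in
    particular on the matrix units. *)
Lemma linear_psd_eq0 r (U : lmodType C) (f : {linear 'M[C]_r -> U}) :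
  (forall D, psd D -> f D = 0) -> forall D, f D = 0.
Proof.
move=> f0.
have polar (u v : 'cV[C]_r) : f (u *m v ^t*) = 0.
  have fu (w : 'cV[C]_r) : f (w *m w ^t*) = 0 by exact/f0/psd_col_adj.
  have := fu (u + v); rewrite adjmxD mulmxDl !mulmxDr !linearD /= !fu.
  rewrite add0r addr0 => /eqP; rewrite addr_eq0 => /eqP sym.
  (* The two cross values are opposite by the expansion at [u + v]; here, since conjugation changes
     the sign of ['i], they come out equal. *)
  have := fu (u + 'i *: v).
  rewrite adjmxD mulmxDl !mulmxDr !linearD /= !fu add0r addr0.
  rewrite linearZ /= map_mxZ /= conjCi -scalemxAr -scalemxAl !linearZ /= sym.
  rewrite scaleNr scalerN opprK -scalerDr -mulr2n -scaler_nat scalerA => /eqP.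
  rewrite scaler_eq0 mulf_eq0 (negPf (neq0Ci C)) pnatr_eq0 /= => /eqP ->.
  by rewrite oppr0.
move=> D; rewrite (matrix_sum_delta D) linear_sum big1 // => i _.
rewrite linear_sum big1 // => j _; rewrite linearZ /=.
suff -> : delta_mx i j = delta_mx i 0 *m (delta_mx j 0 : 'cV[C]_r) ^t*.
  by rewrite polar scaler0.
by rewrite trmx_delta map_delta_mx mul_delta_mx.
Qed.

(** K is the matrix of the identity minus [projv U]; the transposes appear because [lin1_mx] acts on
    row vectors. *)
Lemma vspace_ker d (U : {vspace 'cV[C]_d}) :
  exists K : 'M[C]_d, forall v, v \in U <-> K *m v = 0.
Proof.
pose f (v : 'cV[C]_d) : 'cV[C]_d := v - projv U v.
pose h (u : 'rV[C]_d) := (f u^T)^T.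
have h_lin : linear h.
  move=> a u v; rewrite /h /f -linearP [(a *: u + v)^T]linearP.
  by rewrite [projv U _]linearP opprD addrACA -scalerBr.
pose hl : {linear 'rV[C]_d -> 'rV[C]_d} :=
  HB.pack h (GRing.isLinear.Build _ _ _ _ h h_lin).
exists (lin1_mx hl)^T => v.
have -> : (lin1_mx hl)^T *m v = f v.
  by rewrite -[LHS]trmxK trmx_mul trmxK mul_rV_lin1 /= /h !trmxK.
split=> [/projv_id vE | /eqP]; first by rewrite /f vE subrr.
by rewrite subr_eq0 => /eqP ->; apply: memv_proj.
Qed.

(** * Uniqueness of the Radon--Nikodym derivative *)

Lemma minimal_stinespring_eq0 l n d (Psi : 'M[C]_l -> 'M[C]_n)
    (sigma : 'M[C]_l -> 'M[C]_d) (T : 'M[C]_(d, n)) (G : 'M[C]_d) :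
  minimal_stinespring Psi sigma T ->
  (forall A, G *m sigma A = sigma A *m G) ->
  (forall A, T ^t* *m sigma A *m G *m T = 0) -> G = 0.
Proof.
case=> -[_ _ sigmaM sigmaA] _ Tmin Gcomm G0.
(* Minimality as a cancellation rule: the kernel of K contains every sigma(A) T x, hence is the
   whole space. *)
have kill p (K : 'M[C]_(p, d)) :
    (forall A, K *m sigma A *m T = 0) -> K = 0.
  move=> K0; have Ufull : lker (linfun (mulmx K : 'cV_d -> 'cV_p)) = fullv.
    apply: Tmin => A x; rewrite memv_ker lfunE /= !mulmxA.
    by rewrite K0 mul0mx.
  apply/matrixP => i j; have := memvf (delta_mx j 0 : 'cV[C]_d).
  by rewrite -Ufull memv_ker lfunE /= -colE => /eqP/colP/(_ i); rewrite !mxE.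
have TG A : T ^t* *m sigma A *m G = 0.
  (* Moving G past sigma(B) merges the two factors into sigma(AB). *)
  apply: kill => B.
  by rewrite -[_ *m G *m _]mulmxA Gcomm mulmxA -[_ *m _ *m sigma B]mulmxA
             -sigmaM G0.
(* The T on the left is cancelled by the same rule after taking adjoints. *)
rewrite -[G]trmxCK; apply/eqP.
rewrite [G ^t*]kill ?adjmx0 // => A.
have /(congr1 (fun X => X ^t*)) := TG (A ^t*).
by rewrite !adjmx_mul trmxCK sigmaA trmxCK adjmx0 mulmxA.
Qed.

Lemma radon_nikodym_unique l n d (Phi Psi : 'M[C]_l -> 'M[C]_n)
    (sigma : 'M[C]_l -> 'M[C]_d) (T : 'M[C]_(d, n)) (E F : 'M[C]_d) :
  radon_nikodym Phi Psi sigma T E -> radon_nikodym Phi Psi sigma T F -> E = F.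
Proof.
case=> Tmin _ Ecomm EPhi [_ _ Fcomm FPhi]; apply/eqP; rewrite -subr_eq0.
apply/eqP/(minimal_stinespring_eq0 Tmin) => A.
  by rewrite mulmxBl mulmxBr Ecomm Fcomm.
by rewrite mulmxBr mulmxBl -EPhi -FPhi subrr.
Qed.

(** * Kraus sums as compressions of Kronecker products *)

Lemma ampliation_star_rep l k : star_rep (@ampliation C l k).
Proof.
split.
- by move=> a A B; apply/matrixP => i j; rewrite !mxE mulrDl mulrA.
- exact: tensmx11.
- by move=> A B; rewrite /ampliation tensmx_mul mulmx1.
- by move=> A; rewrite /ampliation adjmx_tens adjmx1.
Qed.

(** This expansion is used both for V and for the composite family L_j V_i; the case D = 1 gives
    back a Kraus sum. *)
Lemma stinespring_op_tens m n r (V : 'I_r -> 'M[C]_(m, n)) (A : 'M[C]_m)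
    (D : 'M[C]_r) :
  (stinespring_op V) ^t* *m (A *t D) *m stinespring_op V
  = \sum_i \sum_j D i j *: ((V i) ^t* *m A *m V j).
Proof.
apply/matrixP => a b; rewrite !mxE sum_mxtens_index summxE exchange_big /=.
under [RHS]eq_bigr do rewrite summxE.
rewrite [RHS]exchange_big /=; apply: eq_bigr => j _.
under [RHS]eq_bigr do rewrite !mxE mulr_sumr.
rewrite [RHS]exchange_big /=; apply: eq_bigr => p _.
rewrite !mxE mxtens_indexK /= sum_mxtens_index exchange_big /= mulr_suml.
apply: eq_bigr => i _; rewrite !mxE mulrA; congr (_ * _).
rewrite mulr_sumr; apply: eq_bigr => q _.
by rewrite tensmxE !mxE mxtens_indexK [_ * D i j]mulrC mulrCA.
Qed.

Lemma weighted_map_tens m n r (V : 'I_r -> 'M[C]_(m, n)) (D : 'M[C]_r)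
    (B : 'M[C]_m) :
  weighted_map V D B
  = (stinespring_op V) ^t* *m (B *t D) *m stinespring_op V.
Proof.
by rewrite /weighted_map /ampliation -[_ *m _ *m (_ *t D)]mulmxA tensmx_mul
           mulmx1 mul1mx.
Qed.

Lemma kraus_weighted_map m n r (Phi : 'M[C]_m -> 'M[C]_n)
    (V : 'I_r -> 'M[C]_(m, n)) :
  kraus Phi V -> forall B, Phi B = weighted_map V 1%:M B.
Proof.
move=> PhiE B; rewrite PhiE weighted_map_tens stinespring_op_tens.
apply: eq_bigr => i _; rewrite (bigD1 i) //= mxE eqxx scale1r big1 ?addr0 //.
by move=> j /negPf ji; rewrite mxE eq_sym ji scale0r.
Qed.

(** * The representation of the composite on the coefficient space *)

Section Composite.
Variables (l m n r s e : nat).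
Variables (L : 'I_s -> 'M[C]_(l, m)) (V : 'I_r -> 'M[C]_(m, n)).

(** The coefficient matrix 1 (x) D vanishes between different j, so a single sum over j survives and
    assembles the Kraus sum of L. *)
Lemma composite_stinespring_tens (A : 'M[C]_l) (D : 'M[C]_r)
    (W := stinespring_op (composite_kraus L V)) :
  W ^t* *m (A *t ((1%:M : 'M_s) *t D)) *m W
  = weighted_map V D (\sum_j (L j) ^t* *m A *m L j).
Proof.
rewrite weighted_map_tens !stinespring_op_tens sum_mxtens_index exchange_big /=.
apply: eq_bigr => i _.
under eq_bigr do rewrite sum_mxtens_index exchange_big /=.
rewrite exchange_big /=; apply: eq_bigr => i' _.
rewrite mulmx_sumr mulmx_suml scaler_sumr; apply: eq_bigr => j _.
rewrite (bigD1 j) //= big1 ?addr0.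
  rewrite tensmxE mxE eqxx mul1r /composite_kraus !mxtens_indexK /=.
  by rewrite adjmx_mul !mulmxA.
by move=> k kj; rewrite tensmxE mxE eq_sym (negPf kj) mul0r scale0r.
Qed.

Lemma relation_spaceE (c : 'cV[C]_(s * r)) :
  relation_space L V c <-> \sum_k c k 0 *: composite_kraus L V k = 0.
Proof.
rewrite /relation_space /= sum_mxtens_index /composite_kraus.
by under [X in _ <-> X = 0]eq_bigr do under eq_bigr do rewrite !mxtens_indexK /=.
Qed.

(** Pairing with a relation gives the (a, b) entry of its vanishing sum; no conjugate enters because
    the pairing is bilinear. *)
Lemma coefficient_space_kraus a b :
  coefficient_space L V (\col_k composite_kraus L V k a b).
Proof.
move=> c /relation_spaceE /matrixP/(_ a b); rewrite summxE mxE => rel0.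
by rewrite -[RHS]rel0; apply: eq_bigr => k _; rewrite !mxE.
Qed.

Variables (Q : 'M[C]_(s * r, e)).
Hypothesis Qbasis : orthonormal_basis (coefficient_space L V) Q.

Lemma orthonormal_basis_fix x :
  coefficient_space L V x -> Q *m Q ^t* *m x = x.
Proof.
case: Qbasis => QQ QE /QE[y ->].
by rewrite mulmxA -[Q *m _ *m Q]mulmxA QQ mulmx1.
Qed.

Lemma coefficient_projection_stinespring
    (W := stinespring_op (composite_kraus L V)) :
  ((1%:M : 'M_l) *t (Q *m Q ^t*)) *m W = W.
Proof.
apply/matrixP => k b; case: (mxtens_indexP k) => a i.
have /orthonormal_basis_fix /matrixP/(_ i 0) := coefficient_space_kraus a b.
rewrite [RHS]mxE => fixE; rewrite [RHS]mxE mxtens_indexK /= -fixE.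
rewrite [LHS]mxE sum_mxtens_index (bigD1 a) //= [X in _ + X]big1 ?addr0.
  rewrite [RHS]mxE; apply: eq_bigr => j _.
  by rewrite tensmxE [_ a a]mxE eqxx mul1r !mxE mxtens_indexK.
move=> c /negPf ca; apply: big1 => j _.
by rewrite tensmxE [_ a c]mxE eq_sym ca !mul0r.
Qed.

(** These vectors run through the entrywise conjugate of the coefficient space. A relation among
    them pairs to zero with each column of Q, so [y *m Q ^t* *m Q] is zero. *)
Lemma relation_space_eq0 (y : 'rV[C]_e) :
  relation_space L V (y *m Q ^t*)^T -> y = 0.
Proof.
case: Qbasis => QQ QE yrel.
have y0 : y *m Q ^t* *m Q = 0.
  apply/rowP => b; rewrite [RHS]mxE.
  have /(_ _ yrel) : coefficient_space L V (col b Q).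
    by apply/QE; exists (delta_mx b 0); rewrite colE.
  move=> pair0; rewrite -[RHS]pair0 [LHS]mxE.
  by apply: eq_bigr => k _; rewrite !mxE.
by rewrite -[y]mulmx1 -QQ mulmxA.
Qed.

Lemma composite_stinespring_span (U : {vspace 'cV[C]_(l * e)}) :
  (forall A (x : 'cV[C]_n),
     ampliation e A *m composite_stinespring_op L V Q *m x \in U) ->
  U = fullv.
Proof.
move=> spanU; have [K KU] := vspace_ker U.
suff K0 : K = 0.
  by apply/vspaceP => v; rewrite memvf; apply/KU; rewrite K0 mul0mx.
apply/matrixP => i k; case: (mxtens_indexP k) => a b.
(* Row i of K splits along C^l into functionals y; each becomes a relation after multiplication by
   [Q ^t*]. *)
pose y : 'rV[C]_e := \row_b K i (mxtens_index (a, b)).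
suff /rowP/(_ b) : y = 0 by rewrite !mxE.
apply/relation_space_eq0/relation_spaceE/matrixP => c j.
(* The matrix unit carries block c to block a, so row i of this equation is the (c, j) entry of the
   relation. *)
have /KU/colP/(_ i) := spanU (delta_mx a c) (delta_mx j 0).
rewrite /ampliation /composite_stinespring_op [_ *t _ *m (_ *m _)]mulmxA.
rewrite tensmx_mul mulmx1 mul1mx !mulmxA -colE !mxE => <-.
rewrite summxE [RHS]sum_mxtens_index (bigD1 c) //= [X in _ = _ + X]big1 ?addr0.
  apply: eq_bigr => p _; rewrite !mxE mxtens_indexK /=; congr (_ * _).
  rewrite sum_mxtens_index (bigD1 a) //= [X in _ + X]big1 ?addr0.
    by apply: eq_bigr => q _; rewrite tensmxE !mxE !eqxx mul1r.
  move=> a' /negPf a'a; apply: big1 => q _.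
  by rewrite tensmxE !mxE a'a mul0r mulr0.
move=> c' /negPf c'c; apply: big1 => p _.
rewrite mxE big1 ?mul0r // => q _.
case: (mxtens_indexP q) => a' b'.
by rewrite tensmxE !mxE c'c andbF mul0r mulr0.
Qed.

(** W factors as (1 (x) Q) T, because [Q *m Q ^t*] fixes its coefficients; absorbing both factors 1
    (x) Q into the middle compresses X. *)
Lemma composite_stinespring_compress (A : 'M[C]_l) (X : 'M[C]_(s * r))
    (W := stinespring_op (composite_kraus L V))
    (T := composite_stinespring_op L V Q) :
  T ^t* *m ampliation e A *m (1%:M *t restriction_mx Q X) *m T
  = W ^t* *m (A *t X) *m W.
Proof.
have WT : (1%:M *t Q) *m T = W.
  by rewrite /T /composite_stinespring_op mulmxA tensmx_mul mul1mx
             coefficient_projection_stinespring.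
clearbody W T; rewrite -WT adjmx_mul adjmx_tens adjmx1 /ampliation !mulmxA.
by rewrite -!(mulmxA (T ^t*)) !tensmx_mul !mul1mx !mulmx1.
Qed.

Lemma compression_linear :
  linear (fun D : 'M[C]_r => restriction_mx Q ((1%:M : 'M_s) *t D)).
Proof.
move=> a D D'.
have -> : (1%:M : 'M_s) *t (a *: D + D') = a *: (1%:M *t D) + 1%:M *t D'.
  by apply/matrixP => i j; rewrite !mxE mulrDr mulrCA.
by rewrite /restriction_mx mulmxDr mulmxDl -scalemxAr -scalemxAl.
Qed.

(** The columns of Q lie in the range of P, so P fixes Q; P being hermitian, it also fixes [Q ^t*]
    from the right. *)
Lemma restriction_projection (P X : 'M[C]_(s * r)) :
  orthogonal_projection (coefficient_space L V) P ->
  restriction_mx Q (P *m X *m P) = restriction_mx Q X.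
Proof.
case: Qbasis => _ QE [PA PP PE].
have PQ : P *m Q = Q.
  apply/matrixP => i j.
  have /PE[y yE] : coefficient_space L V (col j Q).
    by apply/QE; exists (delta_mx j 0); rewrite colE.
  have /colP/(_ i) : P *m col j Q = col j Q by rewrite yE mulmxA PP.
  by rewrite [col j Q]colE mulmxA -!colE !mxE.
have QP : Q ^t* *m P = Q ^t* by rewrite -{1}PA -adjmx_mul PQ.
by rewrite /restriction_mx !mulmxA QP -mulmxA PQ.
Qed.

(** * The transfer map as a derivative *)

Variables (Omega : 'M[C]_m -> 'M[C]_n) (Lambda : 'M[C]_l -> 'M[C]_m).
Hypotheses (OmegaV : kraus Omega V) (LambdaL : kraus Lambda L).

Lemma composite_minimal_stinespring :
  minimal_stinespring (Omega \o Lambda) (@ampliation C l e)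
    (composite_stinespring_op L V Q).
Proof.
split; [exact: ampliation_star_rep | | exact: composite_stinespring_span].
move=> A; rewrite /= (kraus_weighted_map OmegaV) LambdaL.
(* This is the case D = 1, where 1 (x) 1 compresses to [Q ^t* *m Q], the identity. *)
rewrite -composite_stinespring_tens -composite_stinespring_compress.
rewrite tensmx11 /restriction_mx mulmx1; case: Qbasis => -> _.
by rewrite tensmx11 mulmx1.
Qed.

Lemma composite_radon_nikodym (D : 'M[C]_r) : psd D ->
  radon_nikodym (weighted_map V D \o Lambda) (Omega \o Lambda)
    (@ampliation C l e) (composite_stinespring_op L V Q)
    (1%:M *t restriction_mx Q ((1%:M : 'M_s) *t D)).
Proof.
move=> Dpsd; split; first exact: composite_minimal_stinespring.
- exact/psd_tens1/psd_congr/psd_tens1.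
- by move=> A; rewrite /ampliation !tensmx_mul !mul1mx !mulmx1.
- move=> A; rewrite composite_stinespring_compress composite_stinespring_tens.
  by rewrite /= LambdaL.
Qed.

Lemma tensmx1_coefficient_inj : injective (tensmx (1%:M : 'M[C]_l) : 'M_e -> _).
Proof.
move=> X Y XY; case: (posnP l) => [l0 | l_gt0].
  (* For l = 0 the products L_j V_i have no rows, so every family is a relation, the coefficient
     space is zero and so is every Z. *)
  suff Z0 (Z : 'M[C]_e) : Z = 0 by rewrite [X]Z0 [Y]Z0.
  apply/row_matrixP => i; rewrite row0; apply/relation_space_eq0/relation_spaceE.
  by apply/matrixP => -[a a_lt]; exfalso; rewrite l0 in a_lt.
apply/eqP; rewrite -subr_eq0; apply/eqP/(tensmx0_inj l_gt0).
have -> : (1%:M : 'M[C]_l) *t (X - Y) = 1%:M *t X - 1%:M *t Y.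
  by apply/matrixP => i j; rewrite !mxE mulrBr.
by rewrite XY subrr.
Qed.

Lemma pullback_transferP (T : 'M[C]_r -> 'M[C]_e) :
  pullback_transfer Omega Lambda V L Q T <->
  forall D, T D = restriction_mx Q ((1%:M : 'M_s) *t D).
Proof.
split=> [[Tlin TRN] D | TE].
  pose S D := restriction_mx Q ((1%:M : 'M_s) *t D).
  (* Linearity of the difference reduces the comparison to psd matrices, where T and S both give the
     derivative. *)
  have TS_lin : linear (fun D => T D - S D).
    move=> a D1 D2; rewrite Tlin [S _]compression_linear.
    by rewrite opprD addrACA -scalerBr.
  pose TS : {linear 'M[C]_r -> 'M[C]_e} :=
    HB.pack (fun D => T D - S D) (GRing.isLinear.Build _ _ _ _ _ TS_lin).
  apply/eqP; rewrite -subr_eq0; apply/eqP.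
  apply: (linear_psd_eq0 (f := TS)) => {}D Dpsd; apply/eqP.
  rewrite subr_eq0; apply/eqP/tensmx1_coefficient_inj.
  exact: (radon_nikodym_unique (TRN D Dpsd) (composite_radon_nikodym Dpsd)).
split=> [a D D' | D Dpsd]; rewrite !TE; first exact: compression_linear.
exact: composite_radon_nikodym.
Qed.

End Composite.
End NumClosed.

Theorem theorem4p1 (R : realType) (l m n r s e : nat)
  (Omega : {linear 'M[R[i]]_m -> 'M[R[i]]_n})
  (Lambda : {linear 'M[R[i]]_l -> 'M[R[i]]_m})
  (V : 'I_r -> 'M[R[i]]_(m, n)) (L : 'I_s -> 'M[R[i]]_(l, m))
  (P : 'M[R[i]]_(s * r)) (Q : 'M[R[i]]_(s * r, e))
  (T : 'M[R[i]]_r -> 'M[R[i]]_e) :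
  completely_positive Omega -> minimal_kraus Omega V ->
  completely_positive Lambda -> kraus Lambda L ->
  orthogonal_projection (coefficient_space L V) P ->
  orthonormal_basis (coefficient_space L V) Q ->
  (pullback_transfer Omega Lambda V L Q T <->
   forall D : 'M[R[i]]_r,
     T D = restriction_mx Q (P *m ((1%:M : 'M_s) *t D) *m P)).
Proof.
move=> _ [OmegaV _] _ LambdaL Pproj Qbasis.
(* In the basis Q both factors P drop out, leaving the compression of 1 (x) D. *)
have PQ := restriction_projection Qbasis _ Pproj.
split=> [/(pullback_transferP Qbasis OmegaV LambdaL) TE D | TE].
  by rewrite PQ.
by apply/(pullback_transferP Qbasis OmegaV LambdaL) => D; rewrite TE PQ.
Qed.
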